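(* For every $k\geq2$, the operad $k\text{-}\overline{\mathrm{HG}}$ of refined $k$-hypergraph skew-symmetric quadratic data is the smallest sub-operad of the operad $k\text{-}\mathrm{HG}$ of $k$-hypergraph skew-symmetric quadratic data.
   Context: Work over $\mathbb Q$. For a vector space $V$ (in degree $0$), $V^{\wedge2}\subset V^{\otimes2}$ is spanned by $x\wedge y=x\otimes y-y\otimes x$. The category $\mathbf{QD}^-$ of skew-symmetric quadratic data has objects $(V,R)$ with $R\subset V^{\wedge2}$ and morphisms the linear maps $f$ with $f^{\otimes2}(R)\subset S$; its symmetric monoidal product is $(V,R)\oplus(W,S)=(V\oplus W,R\oplus[V,W]_-\oplus S)$, with $[V,W]_-=\langle v\otimes w-w\otimes v\mid v\in V,w\in W\rangle$, and unit $(0,0)$. An operad in $(\mathbf{QD}^-,\oplus)$ is a (symmetric, unital, with partial compositions) operad in this symmetric monoidal category, with components in all arities $n\ge0$. Fix $k\ge2$. Let $V(n)$ be the vector space with basis $t^n_I$ indexed by the $k$-element subsets (''hyperedges'') $I\subset\{1,\dots,n\}$ (so $V(n)=0$ for $n<k$). The symmetric group $\mathbb S_n$ acts by permuting the labels. For $1\le p\le n$ let $\pi_p:\{1,\dots,n+m-1\}\to\{1,\dots,n\}$ be the monotone map collapsing $\{p,\dots,p+m-1\}$ to $p$ and mapping the remaining elements bijectively and monotonically onto $\{1,\dots,n\}\setminus\{p\}$. The map $\circ_p:V(n)\oplus V(m)\to V(n+m-1)$ is $t^n_I\mapsto\sum t^{n+m-1}_{I'}$, the sum over all $k$-element subsets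 $I'$ mapped bijectively onto $I$ by $\pi_p$, and $t^m_J\mapsto t^{n+m-1}_{J+p-1}$, where $J+a=\{j+a\mid j\in J\}$. $k\text{-}\mathrm{HG}(n)=(V(n),V(n)^{\wedge2})$. $k\text{-}\overline{\mathrm{HG}}(n)=(V(n),R(n))$, where $R(n)$ is spanned by the $t^n_I\wedge t^n_J$ for hyperedges with $I\cap J=\emptyset$, and by the $t^n_{\{i_1,\dots,i_k\}}\wedge\big(t^n_{J\cup\{i_1\}}+\cdots+t^n_{J\cup\{i_k\}}\big)$ for every hyperedge $I=\{i_1,\dots,i_k\}$ and every set $J$ of $k-1$ elements of $\{1,\dots,n\}$ disjoint from $I$. With the maps $\circ_p$, both are operads in $(\mathbf{QD}^-,\oplus)$. A sub-operad of $k\text{-}\mathrm{HG}$ is a collection of skew-symmetric quadratic data $(V(n),S(n))$, $S(n)\subset V(n)^{\wedge2}$, $n\ge0$, with the same generators $V(n)$, that is stable under the partial composition products $\circ_p$ and the symmetric group actions, i.e. forms an operad in $(\mathbf{QD}^-,\oplus)$ with these structure maps. Sub-operads are ordered by inclusion of the relation spaces $S(n)$ for all $n$. *)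

(* Defs.v *)
From HB Require Import structures.
From mathcomp Require Import all_boot all_order all_fingroup all_algebra.
From mathcomp Require Import zify.

Set Implicit Arguments.
Unset Strict Implicit.
Unset Printing Implicit Defensive.

Import GRing.Theory.
Local Open Scope ring_scope.

(* The tensor square of a finite-dimensional space V is represented by        *)
(* Hom(V^*, V), with x (x) y standing for the map phi |-> phi(x) y.           *)
Notation dual V := 'Hom(V, rat^o).
Notation tens2 V := 'Hom(dual V, V).

Section Tensor.
Variable V : vectType rat.
Implicit Types x y : V.

Definition tens_fun x y (phi : dual V) : V := phi x *: y.

Fact tens_fun_linear x y : linear (tens_fun x y).
Proof.
by move=> a phi psi; rewrite /tens_fun add_lfunE scale_lfunE scalerDl scalerA.
Qed.
HB.instance Definition _ x y :=
  GRing.isLinear.Build rat (dual V) V _ (tens_fun x y) (tens_fun_linear x y).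

Definition tens x y : tens2 V := linfun (tens_fun x y).

Definition wedge x y : tens2 V := tens x y - tens y x.

Lemma tensE x y (phi : dual V) : tens x y phi = phi x *: y.
Proof. by rewrite lfunE. Qed.

Lemma wedgeC x y : wedge x y = - wedge y x.
Proof. by rewrite /wedge opprB. Qed.

Fact wedge_linear x : linear (wedge x).
Proof.
move=> a y z; apply/lfunP => phi.
have phiE : phi (a *: y + z) = a * phi y + phi z by rewrite linearP.
do ![rewrite lfunE /=]; rewrite /tens_fun phiE scalerDr scalerDl.
by rewrite [a *: (_ - _)]scalerBr !scalerA (mulrC (phi x)) opprD addrACA.
Qed.
HB.instance Definition _ x :=
  GRing.isLinear.Build rat V (tens2 V) _ (wedge x) (wedge_linear x).

(* The span of all x /\ y with x in A and y in B; see wedge_spanP.            *)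
Definition wedge_span (A B : {vspace V}) : {vspace tens2 V} :=
  <<[seq wedge x y | x <- vbasis A, y <- vbasis B]>>%VS.

Definition wedge2 : {vspace tens2 V} := wedge_span fullv fullv.

Lemma wedge_span_mem (A B : {vspace V}) x y :
  x \in A -> y \in B -> wedge x y \in wedge_span A B.
Proof.
move=> Ax By; rewrite (coord_vbasis Ax) wedgeC rpredN linear_sum /=.
apply: rpred_sum => i _; rewrite linearZ /= rpredZ // wedgeC rpredN.
rewrite (coord_vbasis By) linear_sum /=.
apply: rpred_sum => j _; rewrite linearZ /= rpredZ //.
by apply/memv_span/allpairs_f; rewrite mem_nth ?size_tuple.
Qed.

Lemma wedge_spanP (A B : {vspace V}) (K : {vspace tens2 V}) :
  reflect {in A & B, forall x y, wedge x y \in K} (wedge_span A B <= K)%VS.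
Proof.
apply: (iffP idP) => [sK x y Ax By | K_wedge].
  by apply: (subvP sK); apply: wedge_span_mem.
apply/span_subvP => _ /allpairsP[[x y] /= [Ax By ->]].
by apply: K_wedge; apply: vbasis_mem.
Qed.

Lemma wedge_in x y : wedge x y \in wedge2.
Proof. by apply: wedge_span_mem; rewrite memvf. Qed.

End Tensor.

Arguments wedge2 V : clear implicits.

Section TensorMap.
Variables (V W : vectType rat) (f : 'Hom(V, W)).

Definition dual_fun (psi : dual W) : dual V := (psi \o f)%VF.

Fact dual_fun_linear : linear dual_fun.
Proof. by move=> a phi psi; rewrite /dual_fun comp_lfunDl comp_lfunZl. Qed.
HB.instance Definition _ :=
  GRing.isLinear.Build rat (dual W) (dual V) _ dual_fun dual_fun_linear.

Definition map_tens2_fun (T : tens2 V) : tens2 W :=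
  (f \o (T \o linfun dual_fun))%VF.

Fact map_tens2_fun_linear : linear map_tens2_fun.
Proof.
move=> a T U; rewrite /map_tens2_fun.
by rewrite comp_lfunDl comp_lfunDr comp_lfunZr comp_lfunZl.
Qed.
HB.instance Definition _ :=
  GRing.isLinear.Build rat (tens2 V) (tens2 W) _ map_tens2_fun
    map_tens2_fun_linear.

(* f (x) f; see map_tens2E.                                                   *)
Definition map_tens2 : 'Hom(tens2 V, tens2 W) := linfun map_tens2_fun.

Lemma map_tens2E (x y : V) : map_tens2 (tens x y) = tens (f x) (f y).
Proof.
apply/lfunP => psi; rewrite lfunE /= /map_tens2_fun !comp_lfunE !tensE.
by rewrite linearZ lfunE /= /dual_fun comp_lfunE.
Qed.

Lemma map_wedge (x y : V) : map_tens2 (wedge x y) = wedge (f x) (f y).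
Proof. by rewrite linearB /= !map_tens2E. Qed.

Lemma map_wedge_span (A B : {vspace V}) :
  (map_tens2 @: wedge_span A B)%VS = wedge_span (f @: A) (f @: B).
Proof.
apply/eqP; rewrite eqEsubv; apply/andP; split.
  rewrite limg_span; apply/span_subvP => _ /mapP[t /allpairsP[[x y] /= [Ax By ->]] ->].
  rewrite map_wedge.
  by apply: wedge_span_mem; rewrite memv_img ?vbasis_mem.
apply/wedge_spanP => _ _ /memv_imgP[x Ax ->] /memv_imgP[y By ->].
by rewrite -map_wedge memv_img ?wedge_span_mem.
Qed.

Lemma map_wedge2 : (map_tens2 @: wedge2 V <= wedge2 W)%VS.
Proof.
by rewrite map_wedge_span; apply/wedge_spanP => x y _ _; apply: wedge_in.
Qed.

End TensorMap.

Record skew_rel (V : vectType rat) := SkewRel {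
  rel_space :> {vspace tens2 V};
  rel_skew : (rel_space <= wedge2 V)%VS }.

(* The objects (V, R) of QD^- and the condition for f to be a morphism.       *)
Record qdata := QData { gens :> vectType rat; rels : skew_rel gens }.

Definition qhom (X Y : qdata) (f : 'Hom(X, Y)) : Prop :=
  (map_tens2 f @: rels X <= rels Y)%VS.

Section Oplus.
Variables V W : vectType rat.

Definition inl_fun (v : V) : V * W := (v, 0).
Definition inr_fun (w : W) : V * W := (0, w).

Fact inl_fun_linear : linear inl_fun.
Proof. by move=> a x y; congr (_, _); rewrite /= scaler0 addr0. Qed.
Fact inr_fun_linear : linear inr_fun.
Proof. by move=> a x y; congr (_, _); rewrite /= scaler0 addr0. Qed.
HB.instance Definition _ :=
  GRing.isLinear.Build rat V (V * W)%type _ inl_fun inl_fun_linear.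
HB.instance Definition _ :=
  GRing.isLinear.Build rat W (V * W)%type _ inr_fun inr_fun_linear.

Definition inlv : 'Hom(V, (V * W)%type) := linfun inl_fun.
Definition inrv : 'Hom(W, (V * W)%type) := linfun inr_fun.

Definition oplus_space (R : {vspace tens2 V}) (S : {vspace tens2 W}) :
    {vspace tens2 (V * W)%type} :=
  (map_tens2 inlv @: R + wedge_span (limg inlv) (limg inrv)
   + map_tens2 inrv @: S)%VS.

Fact oplus_skew (R : skew_rel V) (S : skew_rel W) :
  (oplus_space R S <= wedge2 (V * W)%type)%VS.
Proof.
rewrite !subv_add -andbA; apply/and3P; split.
- exact: subv_trans (limgS _ (rel_skew R)) (map_wedge2 _).
- by apply/wedge_spanP => x y _ _; apply: wedge_in.
- exact: subv_trans (limgS _ (rel_skew S)) (map_wedge2 _).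
Qed.

End Oplus.

Definition oplus (X Y : qdata) : qdata :=
  @QData (X * Y)%type (SkewRel (oplus_skew (rels X) (rels Y))).

(* Indices are 0-based: the input p of an n-ary operation is p : 'I_n, and    *)
(* the inputs of a composition at p form 'I_N with N = n + m - 1. The arity N *)
(* is a parameter, constrained by an equation, so that iterated compositions  *)
(* can be compared without casts.                                             *)

Definition collapse_nat (m p x : nat) : nat :=
  if (x < p)%N then x else if (x < p + m)%N then p else (x.+1 - m)%N.

Fact collapse_subproof n m N (e : N = (n + m).-1) (p : 'I_n) (x : 'I_N) :
  (collapse_nat m p x < n)%N.
Proof.
have ltpn := ltn_ord p; have ltxN := ltn_ord x.
rewrite /collapse_nat; case: (ltnP x p) => ?; first by lia.
by case: (ltnP x (p + m)) => ?; lia.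
Qed.

Definition collapse n m N (e : N = (n + m).-1) (p : 'I_n) (x : 'I_N) : 'I_n :=
  Ordinal (collapse_subproof e p x).

Fact block_subproof n m N (e : N = (n + m).-1) (p : 'I_n) (j : 'I_m) :
  (p + j < N)%N.
Proof. by have := ltn_ord p; have := ltn_ord j; lia. Qed.

Definition block n m N (e : N = (n + m).-1) (p : 'I_n) (j : 'I_m) : 'I_N :=
  Ordinal (block_subproof e p j).

(* The structure maps of an operad in vector spaces with the direct sum as    *)
(* monoidal product. The unit is a map from the zero space, so it is zero.    *)
Record operad_maps (V : nat -> vectType rat) := OperadMaps {
  act : forall n, 'S_n -> 'Hom(V n, V n);
  comp : forall n m N, N = (n + m).-1 -> 'I_n -> 'Hom((V n * V m)%type, V N) }.

(* rho is the permutation sigma o_p tau of the inputs of a composition at p:  *)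
(* tau inside the block of p, followed by sigma on the blocks. These two      *)
(* conditions determine rho; see block_perm_uniq and block_perm_exists.       *)
Definition is_block_perm n m N (e : N = (n + m).-1) (p : 'I_n)
    (sigma : 'S_n) (tau : 'S_m) (rho : 'S_N) : Prop :=
  (forall x, collapse e (sigma p) (rho x) = sigma (collapse e p x)) /\
  (forall j, rho (block e p j) = block e (sigma p) (tau j)).

Lemma collapse_block_inj n m N (e : N = (n + m).-1) (p : 'I_n) (x y : 'I_N) :
  collapse e p x = collapse e p y -> collapse e p x != p -> x = y.
Proof.
move=> /(congr1 val) + /eqP neq_p; have {neq_p}: val (collapse e p x) <> val p.
  by move/val_inj.
move=> /= + eq_xy; have : collapse_nat m p x = collapse_nat m p y by [].
move=> {eq_xy} eq_xy neq_p; apply: val_inj => /=.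
move: eq_xy neq_p; have ltpn := ltn_ord p; rewrite /collapse_nat.
case: (ltnP x p) => ?; case: (ltnP y p) => ?;
  case: (ltnP x (p + m)) => ?; case: (ltnP y (p + m)) => ?; lia.
Qed.

Lemma collapse_eqP n m N (e : N = (n + m).-1) (p : 'I_n) (x : 'I_N) :
  reflect (exists j : 'I_m, x = block e p j) (collapse e p x == p).
Proof.
apply: (iffP eqP) => [/(congr1 val) /= | [j ->]]; rewrite /collapse_nat.
  case: (ltnP x p) => ?; first by lia.
  case: (ltnP x (p + m)) => [ltx _|]; last by lia.
  have ltxm : (x - p < m)%N by lia.
  by exists (Ordinal ltxm); apply: val_inj => /=; lia.
have ltjm := ltn_ord j; apply: val_inj; rewrite /= /collapse_nat.
by case: (ltnP (p + j) p) => ?; [lia | case: (ltnP (p + j) (p + m)); lia].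
Qed.

Lemma collapse_surj n m N (e : N = (n + m).-1) (p i : 'I_n) :
  i != p -> exists x : 'I_N, collapse e p x = i.
Proof.
move=> neq_ip; have {neq_ip} : val i <> val p by move/val_inj/eqP; apply/negP.
have ltin := ltn_ord i; have ltpn := ltn_ord p => /= neq_ip.
pose x := if (i < p)%N then nat_of_ord i else (i + m).-1.
have ltxN : (x < N)%N by rewrite /x; case: (ltnP i p) => ?; lia.
exists (Ordinal ltxN); apply: val_inj; rewrite /= /collapse_nat /x.
case: (ltnP i p) => ?; first by case: (ltnP i p) => ?; lia.
case: (ltnP (i + m).-1 p) => ?; first by lia.
by case: (ltnP (i + m).-1 (p + m)) => ?; lia.
Qed.

Lemma block_inj n m N (e : N = (n + m).-1) (p : 'I_n) : injective (block e p).
Proof. by move=> i j /(congr1 val) /= eq_ij; apply: val_inj => /=; lia. Qed.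

Lemma block_perm_uniq n m N (e : N = (n + m).-1) (p : 'I_n)
    (sigma : 'S_n) (tau : 'S_m) (rho rho' : 'S_N) :
  is_block_perm e p sigma tau rho -> is_block_perm e p sigma tau rho' ->
  rho = rho'.
Proof.
move=> [out_r in_r] [out_r' in_r']; apply/permP => x.
case: (collapse_eqP e p x) => [[j ->] | not_p]; first by rewrite in_r in_r'.
apply: (@collapse_block_inj _ _ _ e (sigma p)); rewrite ?out_r ?out_r' //.
by rewrite (inj_eq perm_inj); apply/collapse_eqP.
Qed.

Lemma block_perm_exists n m N (e : N = (n + m).-1) (p : 'I_n)
    (sigma : 'S_n) (tau : 'S_m) : exists rho, is_block_perm e p sigma tau rho.
Proof.
pose ok (x y : 'I_N) :=
  (collapse e (sigma p) y == sigma (collapse e p x)) &&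
  [forall j, (x == block e p j) ==> (y == block e (sigma p) (tau j))].
have ok_ex x : exists y, ok x y.
  case: (collapse_eqP e p x) => [[j ->] | not_p].
    exists (block e (sigma p) (tau j)); apply/andP; split.
      have /eqP-> : collapse e p (block e p j) == p.
        by apply/collapse_eqP; exists j.
      by apply/collapse_eqP; exists (tau j).
    by apply/forallP => i; apply/implyP => /eqP/block_inj->.
  have neq_p : sigma (collapse e p x) != sigma p.
    by rewrite (inj_eq perm_inj); apply/collapse_eqP.
  have [y yE] := collapse_surj e neq_p; exists y; rewrite /ok yE eqxx /=.
  apply/forallP => j; apply/implyP => /eqP xE; case: not_p.
  by exists j.
pose f x := xchoose (ok_ex x).
have f_out x : collapse e (sigma p) (f x) = sigma (collapse e p x).
  by have /andP[/eqP] := xchooseP (ok_ex x).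
have f_in j : f (block e p j) = block e (sigma p) (tau j).
  by have /andP[_ /forallP/(_ j)] := xchooseP (ok_ex (block e p j));
     rewrite eqxx => /eqP.
have f_inj : injective f.
  move=> x y fxy; have /perm_inj cxy : sigma (collapse e p x) = sigma (collapse e p y).
    by rewrite -!f_out fxy.
  case: (collapse_eqP e p x) => [[i xE] | not_p]; last first.
    by apply: (collapse_block_inj cxy); apply/collapse_eqP.
  have /collapse_eqP[j yE] : collapse e p y == p.
    by rewrite -cxy; apply/collapse_eqP; exists i.
  by move: fxy; rewrite xE yE !f_in => /block_inj/perm_inj->.
by exists (perm f_inj); split=> [x | j]; rewrite permE.
Qed.

(* The operad axioms for (V n, R n) with the structure maps o: these are      *)
(* morphisms of quadratic data and satisfy the unit, associativity and        *)
(* equivariance axioms. Permutations act on the left; the product s * t of    *)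
(* 'S_n is s followed by t.                                                   *)
Record is_operad (V : nat -> vectType rat) (o : operad_maps V)
    (R : forall n, skew_rel (V n)) : Prop := IsOperad {
  act_qhom n (s : 'S_n) : @qhom (QData (R n)) (QData (R n)) (act o s);
  comp_qhom n m N (e : N = (n + m).-1) (p : 'I_n) :
    @qhom (oplus (QData (R n)) (QData (R m))) (QData (R N)) (comp o e p);
  act_id n (x : V n) : act o 1%g x = x;
  act_mul n (s t : 'S_n) (x : V n) : act o (s * t)%g x = act o t (act o s x);
  comp_unitr n (e : n = (n + 1).-1) (p : 'I_n) (x : V n) :
    comp o e p (x, 0 : V 1%N) = x;
  comp_unitl n (e : n = (1 + n).-1) (p : 'I_1) (y : V n) :
    comp o e p (0 : V 1%N, y) = y;
  comp_seq l m n lm mn N (elm : lm = (l + m).-1) (emn : mn = (m + n).-1)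
      (e1 : N = (lm + n).-1) (e2 : N = (l + mn).-1) (p : 'I_l) (q : 'I_m)
      (x : V l) (y : V m) (z : V n) :
    comp o e1 (block elm p q) (comp o elm p (x, y), z) =
    comp o e2 p (x, comp o emn q (y, z));
  comp_par l m n lm ln N (elm : lm = (l + m).-1) (eln : ln = (l + n).-1)
      (e1 : N = (lm + n).-1) (e2 : N = (ln + m).-1) (p r : 'I_l)
      (r' : 'I_lm) (p' : 'I_ln) (x : V l) (y : V m) (z : V n) :
    (p < r)%N -> r' = (r + m).-1 :> nat -> p' = p :> nat ->
    comp o e1 r' (comp o elm p (x, y), z) =
    comp o e2 p' (comp o eln r (x, z), y);
  comp_equivariant n m N (e : N = (n + m).-1) (p : 'I_n)
      (sigma : 'S_n) (tau : 'S_m) (rho : 'S_N) (x : V n) (y : V m) :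
    is_block_perm e p sigma tau rho ->
    comp o e (sigma p) (act o sigma x, act o tau y) =
    act o rho (comp o e p (x, y)) }.

(* S is a sub-operad, on the same generators, of the operad (V, R, o).        *)
Definition is_suboperad (V : nat -> vectType rat) (o : operad_maps V)
    (R S : forall n, skew_rel (V n)) : Prop :=
  (forall n, (S n <= R n)%VS) /\ is_operad o S.

Definition is_smallest_suboperad (V : nat -> vectType rat) (o : operad_maps V)
    (R S : forall n, skew_rel (V n)) : Prop :=
  is_suboperad o R S /\
  forall S', is_suboperad o R S' -> forall n, (S n <= S' n)%VS.

Section Hypergraph.
Variable k : nat.

Definition hedge n := {I : {set 'I_n} | #|I| == k}.

Definition HGgen n : vectType rat := {ffun hedge n -> rat^o}.

(* The basis vector indexed by I if #|I| = k, and 0 otherwise.                *)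
Definition hgen n (I : {set 'I_n}) : HGgen n := [ffun H => (val H == I)%:R].

Definition HGact_fun n (s : 'S_n) (x : HGgen n) : HGgen n :=
  \sum_(I : hedge n) x I *: hgen (s @: val I).

Definition HGcomp_fun n m N (e : N = (n + m).-1) (p : 'I_n)
    (u : HGgen n * HGgen m) : HGgen N :=
  \sum_(I : hedge n) u.1 I *:
    (\sum_(I' : hedge N | (collapse e p @: val I' == val I) &&
                          dinjectiveb (collapse e p) (val I')) hgen (val I'))
  + \sum_(J : hedge m) u.2 J *: hgen (block e p @: val J).

Fact HGact_linear n (s : 'S_n) : linear (HGact_fun s).
Proof.
move=> a x y; rewrite /HGact_fun scaler_sumr -big_split /=.
by apply: eq_bigr => I _; rewrite !ffunE scalerDl scalerA.
Qed.
HB.instance Definition _ n (s : 'S_n) :=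
  GRing.isLinear.Build rat (HGgen n) (HGgen n) _ (HGact_fun s)
    (HGact_linear s).

Fact HGcomp_linear n m N (e : N = (n + m).-1) (p : 'I_n) :
  linear (HGcomp_fun e p).
Proof.
move=> a u v; rewrite /HGcomp_fun scalerDr !scaler_sumr addrACA -!big_split /=.
by congr (_ + _); apply: eq_bigr => I _; rewrite !ffunE scalerDl scalerA.
Qed.
HB.instance Definition _ n m N (e : N = (n + m).-1) (p : 'I_n) :=
  GRing.isLinear.Build rat (HGgen n * HGgen m)%type (HGgen N) _
    (HGcomp_fun e p) (HGcomp_linear e p).

Definition HGmaps : operad_maps HGgen :=
  OperadMaps (fun n s => linfun (HGact_fun s))
             (fun n m N e p => linfun (HGcomp_fun e p)).

Definition HG n : skew_rel (HGgen n) := SkewRel (subvv (wedge2 (HGgen n))).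

Definition HGbar_space n : {vspace tens2 (HGgen n)} :=
  (\sum_(I : hedge n) \sum_(J : hedge n | [disjoint val I & val J])
     <[wedge (hgen (val I)) (hgen (val J))]>
   + \sum_(I : hedge n)
       \sum_(J : {set 'I_n} | (#|J| == k.-1) && [disjoint J & val I])
         <[wedge (hgen (val I)) (\sum_(i in val I) hgen (i |: J))]>)%VS.

Fact HGbar_skew n : (HGbar_space n <= wedge2 (HGgen n))%VS.
Proof.
rewrite subv_add; apply/andP; split; apply/subv_sumP => I _;
  by apply/subv_sumP => J _; rewrite -memvE wedge_in.
Qed.

Definition HGbar n : skew_rel (HGgen n) := SkewRel (@HGbar_skew n).

Lemma hgen_basis n (x : HGgen n) :
  x = \sum_(I : hedge n) x I *: hgen (val I).
Proof.
apply/ffunP => I; rewrite sum_ffunE (bigD1 I) //= !ffunE eqxx.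
rewrite [_ *: _]mulr1 big1 ?addr0 // => J neqJI; rewrite !ffunE.
by rewrite (inj_eq val_inj) eq_sym (negPf neqJI) scaler0.
Qed.

Lemma sum_hgen n (W : lmodType rat) (F : hedge n -> W) (I : hedge n) :
  \sum_(J : hedge n) hgen (val I) J *: F J = F I.
Proof.
rewrite (bigD1 I) //= ffunE eqxx scale1r big1 ?addr0 // => J neqJI.
by rewrite ffunE (inj_eq val_inj) (negPf neqJI) scale0r.
Qed.

Lemma HGact_hgen n (s : 'S_n) (I : hedge n) :
  act HGmaps s (hgen (val I)) = hgen (s @: val I).
Proof. by rewrite lfunE /= /HGact_fun sum_hgen. Qed.

Lemma HGcomp_hgenl n m N (e : N = (n + m).-1) (p : 'I_n) (I : hedge n) :
  comp HGmaps e p (hgen (val I), 0) =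
  \sum_(I' : hedge N | (collapse e p @: val I' == val I) &&
                       dinjectiveb (collapse e p) (val I')) hgen (val I').
Proof.
rewrite lfunE /= /HGcomp_fun /= sum_hgen [X in _ + X]big1 ?addr0 // => J _.
by rewrite ffunE scale0r.
Qed.

Lemma HGcomp_hgenr n m N (e : N = (n + m).-1) (p : 'I_n) (J : hedge m) :
  comp HGmaps e p (0, hgen (val J)) = hgen (block e p @: val J).
Proof.
rewrite lfunE /= /HGcomp_fun /= sum_hgen [X in X + _]big1 ?add0r // => I _.
by rewrite ffunE scale0r.
Qed.

End Hypergraph.

(* Main.v *)
Require Import Defs.
From mathcomp Require Import all_boot all_order all_fingroup all_algebra.
From mathcomp Require Import zify.

Set Implicit Arguments.
Unset Strict Implicit.
Unset Printing Implicit Defensive.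

Import GRing.Theory.
Local Open Scope ring_scope.

(** An element v of V(n) is studied through its coefficients, extended by 0 to
all subsets A of {1, ..., n}.  With c the collapse map and b the inclusion of
the block, composition then reads
<<  (x o_p y)_A = x_(c(A)) + y_(b^-1(A))  >>
for every A with at most k elements: c(A) has k elements exactly when A does
and c is injective on it, and b^-1(A) has k elements exactly when A does and
lies in the block.  Since the formula also holds when A is too small, it can be
iterated, and every operad axiom becomes an identity between images and
preimages of subsets; these axioms do not involve the relations.

The relations are governed by one notion.  Call v collapsible along I when it is
a pullback along the contraction of I to a point: its coefficients vanish on the
sets that meet I twice, and do not change when the only element that a set has
in I is replaced by another element of I.  The space R(n) of the refined data is
spanned by the wedges of t_I with the v collapsible along I ([HGbar_subP],
[wedge_collapsible_in_HGbar]).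

Stability of R under composition holds because pullback along c and extension
along b preserve collapsibility, and because every x o_p 0 is collapsible along
every subset of the block, which c has already contracted; this last fact takes
care of the relations [V, W]_- between the two factors ([HGbar_hcomp]).

Minimality holds because the converse is true for a block I of k elements: what
is collapsible along I is of the form x o_p 0 ([collapsible_is_lift]), whereas
t_I is 0 o_p t for the only hyperedge t of V(k).  Hence the wedge of t_I and v
is the image of a relation in [V, W]_-, which every sub-operad contains; the
action of the permutations brings an arbitrary hyperedge to such a block
([HGbar_minimal]). *)

(** * Coefficients of hypergraph elements *)

Local Notation hact s := (Defs.act (HGmaps _) s).
Local Notation hcomp e p := (Defs.comp (HGmaps _) e p).

Lemma eq_imset_preimset (aT rT : finType) (f : aT -> rT)
    (A : {set rT}) (I : {set aT}) :
  injective f -> #|I| = #|A| -> (A == f @: I) = (I == f @^-1: A).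
Proof.
move=> f_inj cIA; apply/eqP/eqP => [->|eqI].
  by apply/setP => j; rewrite inE mem_imset.
apply/esym/eqP; rewrite eqEcard card_imset // cIA leqnn andbT.
by apply/subsetP => _ /imsetP[j + ->]; rewrite eqI inE.
Qed.

Section Coefficients.
Variable k : nat.
Implicit Types n m N : nat.

(** The coordinate of x at A, taken to be 0 when A is not a hyperedge, so that
images and preimages of hyperedges can be used as indices whatever their
size. *)
Definition coef n (x : HGgen k n) (A : {set 'I_n}) : rat :=
  \sum_(I : hedge k n | val I == A) x I.

Lemma coef_val n (x : HGgen k n) (I : hedge k n) : coef x (val I) = x I.
Proof. by rewrite /coef (eq_bigl (pred1 I)) ?big_pred1_eq. Qed.

Lemma coef_card n (x : HGgen k n) (A : {set 'I_n}) : #|A| != k -> coef x A = 0.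
Proof.
move=> cA; rewrite /coef big_pred0 // => I; apply: contraNF cA => /eqP <-.
exact: (valP I).
Qed.

Lemma coef_lt n (x : HGgen k n) (A : {set 'I_n}) : (#|A| < k)%N -> coef x A = 0.
Proof. by move=> cA; rewrite coef_card // neq_ltn cA. Qed.

Lemma coefP n (x y : HGgen k n) :
  (forall A : {set 'I_n}, #|A| = k -> coef x A = coef y A) -> x = y.
Proof.
move=> exy; apply/ffunP => I; rewrite -!coef_val; apply: exy.
exact/eqP/(valP I).
Qed.

Lemma coef0 n (A : {set 'I_n}) : coef (0 : HGgen k n) A = 0.
Proof. by rewrite /coef big1 // => I _; rewrite ffunE. Qed.

Lemma coefD n (x y : HGgen k n) A : coef (x + y) A = coef x A + coef y A.
Proof. by rewrite /coef -big_split; apply: eq_bigr => I _; rewrite ffunE. Qed.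

Lemma coefZ n a (x : HGgen k n) A : coef (a *: x) A = a * coef x A.
Proof. by rewrite /coef mulr_sumr; apply: eq_bigr => I _; rewrite ffunE. Qed.

Lemma coef_sum n (T : Type) (r : seq T) (P : pred T) (F : T -> HGgen k n) A :
  coef (\sum_(t <- r | P t) F t) A = \sum_(t <- r | P t) coef (F t) A.
Proof.
by apply: (big_morph (fun x => coef x A) (fun x y => coefD x y A) (coef0 A)).
Qed.

Lemma hedgeP n (A : {set 'I_n}) : #|A| = k -> exists I : hedge k n, A = val I.
Proof. by move/eqP=> cA; exists (exist _ A cA). Qed.

Lemma coef_hgen n (I A : {set 'I_n}) :
  #|A| = k -> coef (hgen k I) A = (A == I)%:R.
Proof. by case/hedgeP=> K ->; rewrite coef_val ffunE. Qed.

Lemma coef_hact n (s : 'S_n) (x : HGgen k n) (A : {set 'I_n}) :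
  coef (hact s x) A = coef x (s @^-1: A).
Proof.
have cP : #|s @^-1: A| = #|A| by apply: card_preimset; apply: perm_inj.
have [cA|cA] := eqVneq #|A| k; last by rewrite !coef_card ?cP.
rewrite lfunE /= /HGact_fun coef_sum [RHS]big_mkcond /=.
apply: eq_bigr => I _; rewrite coefZ coef_hgen //.
rewrite eq_imset_preimset ?cA ?(eqP (valP I)) //; last exact: perm_inj.
by case: eqP; rewrite ?mulr1 ?mulr0.
Qed.

Lemma leq_card_block_preim n m N (e : N = (n + m).-1) (p : 'I_n)
    (A : {set 'I_N}) :
  (#|block e p @^-1: A| <= #|A|)%N.
Proof.
rewrite -(card_imset _ (@block_inj _ _ _ e p)) subset_leq_card //.
by apply/subsetP => _ /imsetP[j + ->]; rewrite inE.
Qed.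

(** A hyperedge A lifts exactly one hyperedge when the collapse map is injective
on it, and none otherwise; it comes from the block when its preimage has k
elements.  Both alternatives are detected by the sizes on the right-hand side.
Smaller sets A are allowed so that the formula applies to itself. *)
Lemma coef_hcomp n m N (e : N = (n + m).-1) (p : 'I_n)
    (x : HGgen k n) (y : HGgen k m) (A : {set 'I_N}) : (#|A| <= k)%N ->
  coef (hcomp e p (x, y)) A =
  coef x (collapse e p @: A) + coef y (block e p @^-1: A).
Proof.
have leB := leq_card_block_preim e p A.
rewrite leq_eqVlt => /orP[/eqP cA | ltA]; last first.
  rewrite !coef_lt ?addr0 //; first exact: leq_ltn_trans leB ltA.
  exact: leq_ltn_trans (leq_imset_card _ _) ltA.
rewrite lfunE /= /HGcomp_fun coefD !coef_sum; congr (_ + _).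
  rewrite [RHS]big_mkcond; apply: eq_bigr => I _ /=.
  have [K defA] := hedgeP cA; rewrite {}defA in cA leB *.
  rewrite coefZ coef_sum /=.
  transitivity (x I * ((collapse e p @: val K == val I) &&
                       dinjectiveb (collapse e p) (val K))%:R).
    congr (_ * _); rewrite big_mkcond (bigD1 K) //= coef_hgen // eqxx.
    rewrite big1 => [|J neqJ]; first by rewrite addr0; case: ifP.
    by rewrite coef_hgen // (inj_eq val_inj) [K == J]eq_sym (negPf neqJ); case: ifP.
  rewrite eq_sym; case: eqP => [eqI|]; last by rewrite mulr0.
  suff -> : dinjectiveb (collapse e p) (val K) by rewrite mulr1.
  apply/dinjectiveP/imset_injP; rewrite -eqI cA; exact: (valP I).
rewrite [RHS]big_mkcond; apply: eq_bigr => J _ /=; rewrite coefZ coef_hgen //.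
rewrite eq_imset_preimset ?cA ?(eqP (valP J)) //; last exact: block_inj.
by case: eqP; rewrite ?mulr1 ?mulr0.
Qed.

End Coefficients.

(** * The operad axioms *)

(** The hypotheses say that W maps onto the fibre product of c and b. *)
Lemma preimset_imset_base_change (W X Y Z : finType)
    (b' : W -> X) (c : X -> Y) (c' : W -> Z) (b : Z -> Y) (K : {set X}) :
  (forall w, c (b' w) = b (c' w)) ->
  (forall x z, c x = b z -> exists2 w, b' w = x & c' w = z) ->
  b @^-1: (c @: K) = c' @: (b' @^-1: K).
Proof.
move=> sq lift; apply/setP => z; rewrite inE; apply/imsetP/imsetP => -[].
  move=> x xK /esym/lift[w wx wz]; exists w; last by rewrite wz.
  by rewrite inE wx.
by move=> w; rewrite inE => wK ->; exists (b' w); rewrite ?sq.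
Qed.

Lemma imset_comp_eq (X Y Y' Z : finType) (f : X -> Y) (g : Y -> Z)
    (f' : X -> Y') (g' : Y' -> Z) (K : {set X}) :
  (forall x, g (f x) = g' (f' x)) -> g @: (f @: K) = g' @: (f' @: K).
Proof. by move=> gf; rewrite -!imset_comp; apply: eq_imset => x; apply: gf. Qed.

(** Iterated collapses are nested conditionals: the innermost comparisons have
to be decided first, for the outer ones to be comparisons of linear terms. *)
Ltac split_innermost_comparison :=
  match goal with
  | |- context [if (?a < ?b)%N then _ else _] =>
    lazymatch a with
    | context [if _ then _ else _] => fail
    | _ => case: (ltnP a b) => ?
    end
  end.

Ltac collapse_lia :=
  rewrite /= /collapse_nat; repeat split_innermost_comparison; lia.

Section OperadAxioms.
Variable k : nat.

(** Each equation compares coefficients at a hyperedge A: [coef_hcomp] turns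
both sides into sums of one coefficient per factor, which agree term by term. *)
Lemma HG_is_operad (R : forall n, skew_rel (HGgen k n)) :
  (forall n (s : 'S_n), @qhom (QData (R n)) (QData (R n)) (hact s)) ->
  (forall n m N (e : N = (n + m).-1) (p : 'I_n),
    @qhom (oplus (QData (R n)) (QData (R m))) (QData (R N)) (hcomp e p)) ->
  is_operad (HGmaps k) R.
Proof.
move=> act_q comp_q; split=> //.
- move=> n x; apply: coefP => A _; rewrite coef_hact; congr coef.
  by apply/setP => i; rewrite inE perm1.
- move=> n s t x; apply: coefP => A _; rewrite !coef_hact; congr coef.
  by apply/setP => i; rewrite !inE permM.
(* Composition with the arity-one component collapses nothing. *)
- move=> n e p x; apply: coefP => A cA; rewrite coef_hcomp ?cA // coef0 addr0.
  congr coef; rewrite -[RHS]imset_id; apply: eq_imset => i; apply: val_inj.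
  by have := ltn_ord p; collapse_lia.
- move=> n e p y; apply: coefP => A cA; rewrite coef_hcomp ?cA // coef0 add0r.
  congr coef; apply/setP => i; rewrite inE; congr (_ \in A); apply: val_inj => /=.
  by have := ltn_ord p; lia.
- move=> l m n lm mn N elm emn e1 e2 p q x y z; apply: coefP => A cA.
  have ltp := ltn_ord p; have ltq := ltn_ord q.
  rewrite !coef_hcomp ?cA //; last first.
  + by rewrite (leq_trans (leq_imset_card _ _)) ?cA.
  + by rewrite (leq_trans (leq_card_block_preim _ _ _)) ?cA.
  rewrite -addrA; congr (_ + (_ + _)); congr coef.
  + rewrite -imset_comp; apply: eq_imset => i; apply: val_inj => /=.
    by collapse_lia.
  (* An input sent into the block of the m-ary operation is the image of one of
     the composite inner operation. *)
  + apply: preimset_imset_base_change => [i | i j /(congr1 val) /=].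
      apply: val_inj => /=; have := ltn_ord i; collapse_lia.
    have := ltn_ord i; have := ltn_ord j => ltj lti eqij.
    have lti' : (i - p < mn)%N by move: eqij; collapse_lia.
    exists (Ordinal lti'); apply: val_inj; move: eqij => /=; collapse_lia.
  + apply/setP => i; rewrite !inE; congr (_ \in A); apply: val_inj => /=; lia.
- move=> l m n lm ln N elm eln e1 e2 p r r' p' x y z ltpr r'E p'E.
  have ltp := ltn_ord p; have ltr := ltn_ord r.
  apply: coefP => A cA.
  rewrite !coef_hcomp ?cA //; last first.
  + by rewrite (leq_trans (leq_imset_card _ _)) ?cA.
  + by rewrite (leq_trans (leq_imset_card _ _)) ?cA.
  rewrite addrAC; congr (_ + _ + _); congr coef.
  + apply: imset_comp_eq => i; apply: val_inj; rewrite /= r'E p'E.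
    have := ltn_ord i; collapse_lia.
  (* Collapsing one block is a bijection over the other one, so the fibre
     product is that other block. *)
  + apply/esym; rewrite -[RHS]imset_id.
    apply: preimset_imset_base_change => [i | i j /(congr1 val) /=].
      apply: val_inj => /=; have := ltn_ord i; rewrite r'E p'E; collapse_lia.
    rewrite p'E => eqij; have ltj := ltn_ord j.
    exists j => //; apply: val_inj; rewrite /= r'E.
    by move: eqij; collapse_lia.
  + rewrite -[RHS]imset_id.
    apply: preimset_imset_base_change => [i | i j /(congr1 val) /=].
      apply: val_inj => /=; have := ltn_ord i; rewrite r'E p'E; collapse_lia.
    rewrite r'E => eqij; have ltj := ltn_ord j.
    exists j => //; apply: val_inj; rewrite /= p'E.
    by move: eqij; collapse_lia.
move=> n m N e p s t r x y [out_r in_r]; apply: coefP => A cA.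
rewrite coef_hact !coef_hcomp ?card_preimset ?cA //; last exact: perm_inj.
rewrite !coef_hact; congr (_ + _); congr coef.
  apply: preimset_imset_base_change => // i j eqij.
  exists (r^-1%g i); first by rewrite permKV.
  by apply: (@perm_inj _ s); rewrite -out_r permKV.
by apply/setP => j; rewrite !inE in_r.
Qed.

End OperadAxioms.

(** * Wedges and morphisms of quadratic data *)

Section WedgeMembership.
Variable V : vectType rat.
Implicit Types (x y : V) (K : {vspace tens2 V}).

Lemma wedgeDr x y z : wedge x (y + z) = wedge x y + wedge x z.
Proof. by have := wedge_linear x 1 y z; rewrite !scale1r. Qed.

Lemma wedge0r x : wedge x 0 = 0.
Proof. by apply: (@addrI _ (wedge x 0)); rewrite -wedgeDr !addr0. Qed.

Lemma wedgeZr x a y : wedge x (a *: y) = a *: wedge x y.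
Proof. by have := wedge_linear x a y 0; rewrite wedge0r !addr0. Qed.

Lemma wedge_sumr_mem K x (T : Type) (r : seq T) (P : pred T) (F : T -> V) :
  (forall t, P t -> wedge x (F t) \in K) ->
  wedge x (\sum_(t <- r | P t) F t) \in K.
Proof.
move=> FK; apply: (big_ind (fun y => wedge x y \in K)) => //.
  by rewrite wedge0r mem0v.
by move=> y z yK zK; rewrite wedgeDr; apply: memvD.
Qed.

Lemma wedge_swap_mem K x y : wedge x y \in K -> wedge y x \in K.
Proof. by rewrite wedgeC memvN. Qed.

Lemma wedge_suml_mem K y (T : Type) (r : seq T) (P : pred T) (F : T -> V) :
  (forall t, P t -> wedge (F t) y \in K) ->
  wedge (\sum_(t <- r | P t) F t) y \in K.
Proof.
by move=> FK; apply: wedge_swap_mem; apply: wedge_sumr_mem => t /FK/wedge_swap_mem.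
Qed.

End WedgeMembership.

Lemma limg_sub_lpreim (V W : vectType rat) (f : 'Hom(V, W))
    (U : {vspace V}) (K : {vspace W}) :
  (U <= f @^-1: K)%VS -> (f @: U <= K)%VS.
Proof.
move/(limgS f)/subv_trans; apply.
by rewrite -lpreim_cap_limg lpreimK ?capvSr ?capvSl.
Qed.

Lemma inlvE (V W : vectType rat) (v : V) : inlv V W v = (v, 0).
Proof. by rewrite lfunE. Qed.

Lemma inrvE (V W : vectType rat) (w : W) : inrv V W w = (0, w).
Proof. by rewrite lfunE. Qed.

Lemma oplus_qhom_sub (V W U : vectType rat) (R : {vspace tens2 V})
    (S : {vspace tens2 W}) (T : {vspace tens2 U}) (f : 'Hom((V * W)%type, U)) :
  (R <= (map_tens2 f \o map_tens2 (inlv V W)) @^-1: T)%VS ->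
  (S <= (map_tens2 f \o map_tens2 (inrv V W)) @^-1: T)%VS ->
  (forall v w, wedge (f (v, 0)) (f (0, w)) \in T) ->
  (map_tens2 f @: oplus_space R S <= T)%VS.
Proof.
move=> RT ST VW; rewrite /oplus_space !limgD !subv_add -!limg_comp.
apply/andP; split; last exact: limg_sub_lpreim.
apply/andP; split; [exact: limg_sub_lpreim | rewrite map_wedge_span].
apply/wedge_spanP => x y /memv_imgP[x' /memv_imgP[v _ ->] ->].
by move=> /memv_imgP[y' /memv_imgP[w _ ->] ->]; rewrite inlvE inrvE; apply: VW.
Qed.

Lemma qhom_oplus_wedge (X Y Z : qdata) (f : 'Hom((X * Y)%type, Z))
    (x : X) (y : Y) :
  @qhom (oplus X Y) Z f -> wedge (f (x, 0)) (f (0, y)) \in rels Z.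
Proof.
move/subvP; apply; rewrite -map_wedge; apply: memv_img => /=.
apply: (subvP (addvSl _ _)); apply: (subvP (addvSr _ _)).
by apply: wedge_span_mem; rewrite -?inlvE -?inrvE memv_img ?memvf.
Qed.

Lemma qhom_wedge2 (X Y : qdata) (f : 'Hom(X, Y)) :
  (wedge2 Y <= rels Y)%VS -> @qhom X Y f.
Proof.
move=> Y2; apply: subv_trans Y2.
exact: subv_trans (limgS _ (rel_skew _)) (map_wedge2 _).
Qed.

Lemma mem_lpreim_inl (V W U : vectType rat) (T : {vspace tens2 U})
    (f : 'Hom((V * W)%type, U)) (x y : V) :
  (wedge x y \in (map_tens2 f \o map_tens2 (inlv V W)) @^-1: T)%VS =
  (wedge (f (x, 0)) (f (y, 0)) \in T).
Proof. by rewrite -memv_preim comp_lfunE !map_wedge !inlvE. Qed.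

Lemma mem_lpreim_inr (V W U : vectType rat) (T : {vspace tens2 U})
    (f : 'Hom((V * W)%type, U)) (x y : W) :
  (wedge x y \in (map_tens2 f \o map_tens2 (inrv V W)) @^-1: T)%VS =
  (wedge (f (0, x)) (f (0, y)) \in T).
Proof. by rewrite -memv_preim comp_lfunE !map_wedge !inrvE. Qed.

(** * Collapsible elements span the refined relations *)

Section Collapsible.
Variable k : nat.
Implicit Types n m N : nat.

(** The image of the pullback along the contraction of I to a point: a set maps
to a k-element set only if it meets I at most once, and the place where it meets
I is forgotten. *)
Definition collapsible n (I : {set 'I_n}) (v : HGgen k n) : Prop :=
  (forall L : {set 'I_n}, (1 < #|L :&: I|)%N -> coef v L = 0) /\
  (forall (J : {set 'I_n}) i j, [disjoint J & I] -> i \in I -> j \in I ->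
     coef v (i |: J) = coef v (j |: J)).

(** If M meets I, both coefficients vanish: either i |: M is M, which is too
small, or i |: M meets I twice. *)
Lemma collapsible_exchange n (I M : {set 'I_n}) (v : HGgen k n) i j :
  collapsible I v -> (#|M| < k)%N -> i \in I -> j \in I ->
  coef v (i |: M) = coef v (j |: M).
Proof.
move=> [v2 v1] ltMk Ii Ij; have [dMI|] := boolP [disjoint M & I].
  exact: v1.
rewrite -setI_eq0 => /set0Pn[z /setIP[Mz Iz]].
suff v0 x : x \in I -> coef v (x |: M) = 0 by rewrite !v0.
move=> Ix; have [->|neq_xz] := eqVneq x z.
  by rewrite coef_lt // (setUidPr _) // sub1set.
apply: v2; apply/card_gt1P; exists x, z => //; rewrite !inE ?Ix ?Iz ?eqxx //.
by rewrite Mz orbT.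
Qed.

Lemma eq_setU1_disjoint n (A I J : {set 'I_n}) i :
  i \in I -> [disjoint J & I] ->
  (A == i |: J) = (A :&: I == [set i]) && (A :\: I == J).
Proof.
move=> Ii dJI; apply/eqP/andP => [->|[/eqP eqAI /eqP eqAD]]; last first.
  by rewrite -[LHS](setID A I) eqAI eqAD.
have J0 : J :&: I = set0 by apply/eqP; rewrite setI_eq0.
rewrite setIUl setDUl J0 setU0 (setIidPl _) ?sub1set // eqxx.
have -> : [set i] :\: I = set0 by apply/eqP; rewrite setD_eq0 sub1set.
by rewrite set0U; split=> //; apply/eqP/setDidPl.
Qed.

Lemma collapsible_card_le1 n (I : {set 'I_n}) (v : HGgen k n) :
  (#|I| <= 1)%N -> collapsible I v.
Proof.
move=> I1; split=> [L | J i j _ Ii Ij]; last by rewrite (card_le1_eqP I1 i j).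
by rewrite ltnNge (leq_trans (subset_leq_card (subsetIr L I)) I1).
Qed.

Lemma collapsible_disjoint n (I J : {set 'I_n}) :
  [disjoint I & J] -> collapsible I (hgen k J).
Proof.
rewrite -setI_eq0 setIC => /eqP dJI.
have coefJ A : (0 < #|A :&: I|)%N -> coef (hgen k J) A = 0.
  have [cA|cA] := eqVneq #|A| k; last by rewrite coef_card.
  by rewrite coef_hgen //; case: eqP => // ->; rewrite dJI cards0.
split=> [L /ltnW /coefJ // | M i j _ Ii Ij].
rewrite !coefJ // card_gt0; apply/set0Pn; [exists j | exists i];
  by rewrite !inE eqxx.
Qed.

Lemma collapsible_star n (I J : {set 'I_n}) :
  [disjoint J & I] -> collapsible I (\sum_(i in I) hgen k (i |: J)).
Proof.
move=> dJI.
have coefJ A : coef (\sum_(i in I) hgen k (i |: J)) A =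
    \sum_(i in I) ((#|A| == k) && (A :&: I == [set i]) && (A :\: I == J))%:R.
  rewrite coef_sum; apply: eq_bigr => i Ii.
  case: eqP => [cA|/eqP cA]; last by rewrite coef_card.
  by rewrite coef_hgen // (eq_setU1_disjoint _ Ii dJI).
split=> [L L2 | M i j dMI Ii Ij].
  rewrite coefJ big1 // => i _; case: eqP => //= _.
  by case: eqP => //= eqL; rewrite eqL cards1 in L2.
have MI0 : M :&: I = set0 by apply/eqP; rewrite setI_eq0.
have coefM x : x \in I -> coef (\sum_(i in I) hgen k (i |: J)) (x |: M) =
    ((#|M|.+1 == k) && (M == J))%:R.
  move=> Ix; rewrite coefJ (bigD1 x) //= big1 ?addr0 => [|y /andP[_ neq_yx]].
    rewrite cardsU1 (disjointFl dMI Ix).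
    have := eq_setU1_disjoint (x |: M) Ix dMI; rewrite eqxx => /esym/andP[-> /eqP->].
    by rewrite andbT.
  have := eq_setU1_disjoint (x |: M) Ix dMI; rewrite eqxx => /esym/andP[/eqP-> _].
  by rewrite (inj_eq set1_inj) [x == y]eq_sym (negPf neq_yx) andbF.
by rewrite !coefM.
Qed.

(** Both families of generators of the refined relations are wedges with a
collapsible element. *)
Lemma HGbar_subP n (K : {vspace tens2 (HGgen k n)}) :
  (forall (I : hedge k n) v, collapsible (val I) v ->
     wedge (hgen k (val I)) v \in K) ->
  (HGbar_space k n <= K)%VS.
Proof.
move=> K_wedge; rewrite subv_add; apply/andP; split; apply/subv_sumP => I _.
  apply/subv_sumP => J dIJ; rewrite -memvE; apply: K_wedge.
  exact: collapsible_disjoint.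
apply/subv_sumP => J /andP[_ dJI]; rewrite -memvE; apply: K_wedge.
exact: collapsible_star.
Qed.

(** The coefficients of v at the sets disjoint from I give generators of the
first kind.  The sets meeting I once fall into families i |: J, with i in I, on
which the coefficient is constant: each family gives a generator of the second
kind. *)
Lemma wedge_collapsible_in_HGbar n (I : hedge k n) (v : HGgen k n) :
  (0 < k)%N -> collapsible (val I) v ->
  wedge (hgen k (val I)) v \in HGbar_space k n.
Proof.
move=> k_gt0 [v2 v1].
have [i0 Ii0] : exists i, i \in val I by apply/card_gt0P; rewrite (eqP (valP I)).
pose stars := [pred J : {set 'I_n} | (#|J| == k.-1) && [disjoint J & val I]].
(* The value of v on the family of J is read at the arbitrary element i0. *)
have -> : v =
    \sum_(L : hedge k n | [disjoint val I & val L]) v L *: hgen k (val L)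
    + \sum_(J in stars) coef v (i0 |: J) *: \sum_(i in val I) hgen k (i |: J).
  apply: coefP => A cA; rewrite coefD !coef_sum.
  have [K defA] := hedgeP cA.
  have stars0 : (#|A :&: val I| != 1)%N ->
      \sum_(J in stars)
        coef (coef v (i0 |: J) *: \sum_(i in val I) hgen k (i |: J)) A = 0.
    move=> nA1; rewrite big1 // => J /andP[_ dJI].
    rewrite coefZ coef_sum big1 ?mulr0 // => i Ii.
    rewrite coef_hgen // (eq_setU1_disjoint _ Ii dJI).
    by case: eqP => // eqAI; rewrite eqAI cards1 in nA1.
  have disj0 : ~~ [disjoint val I & A] ->
      \sum_(L : hedge k n | [disjoint val I & val L])
        coef (v L *: hgen k (val L)) A = 0.
    move=> ndA; rewrite big1 // => L dIL; rewrite coefZ coef_hgen //.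
    by case: eqP => [eqAL|_]; [rewrite eqAL dIL in ndA | rewrite mulr0].
  have ndA : [disjoint val I & A] = (#|A :&: val I| == 0).
    by rewrite cards_eq0 setI_eq0 disjoint_sym.
  case: (ltngtP #|A :&: val I| 1) => cAI.
  - have dA : [disjoint val I & A] by rewrite ndA -leqn0.
    rewrite stars0 ?addr0; last by rewrite neq_ltn cAI.
    rewrite (bigD1 K) -?defA //= coefZ coef_hgen // eqxx mulr1.
    rewrite big1 ?addr0 => [|L /andP[_ neqLK]].
      by rewrite defA coef_val.
    rewrite coefZ coef_hgen // defA (inj_eq val_inj) [K == L]eq_sym.
    by rewrite (negPf neqLK) mulr0.
  - rewrite v2 // stars0 ?disj0 ?addr0 // ?ndA; last by rewrite neq_ltn cAI orbT.
    by rewrite -lt0n ltnW.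
  - rewrite disj0 ?add0r; last by rewrite ndA cAI.
    have /cards1P[i eqAI] : #|A :&: val I| == 1%N by apply/eqP.
    have /setIP[Ai Ii] : i \in A :&: val I by rewrite eqAI set11.
    have dDI : [disjoint A :\: val I & val I].
      by rewrite -setI_eq0 setDE -setIA [~: _ :&: _]setIC setICr setI0.
    have defAi : A = i |: (A :\: val I).
      by apply/eqP; rewrite (eq_setU1_disjoint _ Ii dDI) eqAI !eqxx.
    rewrite (bigD1 (A :\: val I)) /=; last first.
      by rewrite inE dDI andbT cardsD eqAI cards1 cA subn1 eqxx.
    rewrite coefZ coef_sum (bigD1 i) //= -defAi coef_hgen // eqxx.
    rewrite big1 => [|j /andP[Ij neq_ji]]; last first.
      rewrite coef_hgen // (eq_setU1_disjoint _ Ij dDI) eqAI (inj_eq set1_inj).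
      by rewrite [i == j]eq_sym (negPf neq_ji).
    rewrite addr0 mulr1 big1 ?addr0 => [|J /andP[/andP[_ dJI] neqJ]].
      by rewrite {1}defAi; apply: v1.
    rewrite coefZ coef_sum big1 ?mulr0 // => j Ij.
    rewrite coef_hgen // (eq_setU1_disjoint _ Ij dJI) [_ == J]eq_sym.
    by rewrite (negPf neqJ) andbF.
rewrite wedgeDr; apply: memvD; apply: wedge_sumr_mem => L sL;
  rewrite wedgeZr; apply: memvZ; rewrite memvE /HGbar_space.
- apply: subv_trans (addvSl _ _); apply: (sumv_sup I) => //.
  exact: (sumv_sup L).
- apply: subv_trans (addvSr _ _); apply: (sumv_sup I) => //.
  exact: (sumv_sup L).
Qed.

End Collapsible.

(** * Stability of the refined relations *)

Section Stability.
Variable k : nat.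
Implicit Types n m N : nat.

Lemma collapsible_hact n (s : 'S_n) (I : {set 'I_n}) (v : HGgen k n) :
  collapsible I v -> collapsible (s @: I) (hact s v).
Proof.
move=> [v2 v1]; have s_inj := @perm_inj _ s; split=> [L | J i j].
  rewrite coef_hact => L2; apply: v2.
  rewrite -(card_imset _ s_inj) imsetI; last by move=> x y _ _ /s_inj.
  suff -> : s @: (s @^-1: L) = L by [].
  by apply/esym/eqP; rewrite eq_imset_preimset // card_preimset.
move=> + /imsetP[i' Ii' ->] /imsetP[j' Ij' ->].
rewrite -setI_eq0 => /eqP dJI; rewrite !coef_hact.
have pre x : s @^-1: (s x |: J) = x |: (s @^-1: J).
  by apply/setP => z; rewrite !inE (inj_eq s_inj).
rewrite !pre; apply: v1 => //; rewrite -setI_eq0; apply/eqP/setP => z.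
by have /setP/(_ (s z)) := dJI; rewrite !inE mem_imset.
Qed.

Section Composition.
Variables (n m N : nat) (e : N = (n + m).-1) (p : 'I_n).

(** Collapsing the block and then contracting the image of I to a point factors
through the contraction of I. *)
Lemma collapsible_lift (I : {set 'I_N}) (v : HGgen k n) :
  collapsible (collapse e p @: I) v -> collapsible I (hcomp e p (v, 0)).
Proof.
move=> vI; have [v2 _] := vI; split=> [L L2 | J i j dJI Ii Ij].
  have [cL|cL] := eqVneq #|L| k; last by rewrite coef_card.
  rewrite coef_hcomp ?cL // coef0 addr0.
  (* If two elements of L are identified, the image of L is not a hyperedge. *)
  have [ccL|] := eqVneq #|collapse e p @: L| k; last exact: coef_card.
  have /imset_injP c_inj : #|collapse e p @: L| == #|L| by rewrite ccL cL.
  apply: v2; apply: leq_trans L2 _.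
  rewrite -(card_in_imset (f := collapse e p)).
    by rewrite subset_leq_card // subsetI !imsetS ?subsetIl ?subsetIr.
  by move=> x y /setIP[Lx _] /setIP[Ly _]; apply: c_inj.
have cards x : x \in I -> #|x |: J| = #|J|.+1.
  by move=> Ix; rewrite cardsU1 (disjointFl dJI Ix).
have [cJ|cJ] := eqVneq #|J|.+1 k; last by rewrite !coef_card ?cards.
rewrite !coef_hcomp ?cards ?cJ // !coef0 !addr0 !imsetU1.
apply: (collapsible_exchange vI); rewrite ?imset_f //.
by rewrite -cJ ltnS leq_imset_card.
Qed.

(** The block is already collapsed to the point p. *)
Lemma collapsible_block_lift (J : {set 'I_m}) (x : HGgen k n) :
  collapsible (block e p @: J) (hcomp e p (x, 0)).
Proof.
apply/collapsible_lift/collapsible_card_le1; rewrite -(cards1 p).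
apply/subset_leq_card/subsetP => _ /imsetP[_ /imsetP[j _ ->] ->].
by rewrite inE; apply/collapse_eqP; exists j.
Qed.

Lemma collapsible_block (J : {set 'I_m}) (y : HGgen k m) :
  collapsible J y -> collapsible (block e p @: J) (hcomp e p (0, y)).
Proof.
move=> yJ; have [y2 _] := yJ; have b_inj := @block_inj _ _ _ e p.
split=> [L L2 | M i j dMJ].
  have [cL|cL] := eqVneq #|L| k; last by rewrite coef_card.
  rewrite coef_hcomp ?cL // coef0 add0r; apply: y2; apply: leq_trans L2 _.
  rewrite -(card_imset _ b_inj) subset_leq_card //.
  apply/subsetP => x /setIP[Lx /imsetP[j Jj defx]]; rewrite defx in Lx *.
  by rewrite imset_f // !inE Lx.
move=> /imsetP[i' Ji ->] /imsetP[j' Jj ->].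
have cards x : x \in J -> #|block e p x |: M| = #|M|.+1.
  by move=> Jx; rewrite cardsU1 (disjointFl dMJ) // imset_f.
have [cM|cM] := eqVneq #|M|.+1 k; last by rewrite !coef_card ?cards.
rewrite !coef_hcomp ?cards ?cM // !coef0 !add0r.
have pre x : block e p @^-1: (block e p x |: M) = x |: (block e p @^-1: M).
  by apply/setP => z; rewrite !inE (inj_eq b_inj).
rewrite !pre; apply: (collapsible_exchange yJ) => //.
by rewrite -cM ltnS leq_card_block_preim.
Qed.

End Composition.

Hypothesis k_gt0 : (0 < k)%N.

Lemma HGbar_hact n (s : 'S_n) :
  @qhom (QData (HGbar k n)) (QData (HGbar k n)) (hact s).
Proof.
rewrite /qhom /=; apply/limg_sub_lpreim/HGbar_subP => I v vI.
rewrite -memv_preim map_wedge HGact_hgen.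
have cs : #|s @: val I| = k by rewrite card_imset ?(eqP (valP I)) //; apply: perm_inj.
have [K defK] := hedgeP cs; rewrite defK; apply: wedge_collapsible_in_HGbar => //.
by rewrite -defK; apply: collapsible_hact.
Qed.

Lemma hcomp_rightE n m N (e : N = (n + m).-1) (p : 'I_n) (y : HGgen k m) :
  hcomp e p (0, y) = \sum_(J : hedge k m) y J *: hgen k (block e p @: val J).
Proof.
by rewrite lfunE /= /HGcomp_fun big1 ?add0r // => I _; rewrite ffunE scale0r.
Qed.

(** The three summands of the relations of a direct sum are preserved for
different reasons: wedges of two lifts by [collapsible_lift], wedges inside the
block by [collapsible_block], mixed wedges by [collapsible_block_lift]. *)
Lemma HGbar_hcomp n m N (e : N = (n + m).-1) (p : 'I_n) :
  @qhom (oplus (QData (HGbar k n)) (QData (HGbar k m))) (QData (HGbar k N))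
    (hcomp e p).
Proof.
have block_hedge (J : hedge k m) :
    exists K : hedge k N, block e p @: val J = val K.
  by apply: hedgeP; rewrite card_imset ?(eqP (valP J)) //; apply: block_inj.
apply: oplus_qhom_sub => /=.
- apply: HGbar_subP => I v vI; rewrite mem_lpreim_inl HGcomp_hgenl.
  apply: wedge_suml_mem => K /andP[/eqP cK _].
  apply: wedge_collapsible_in_HGbar => //; apply: collapsible_lift => //.
  by rewrite cK.
- apply: HGbar_subP => J v vJ; rewrite mem_lpreim_inr HGcomp_hgenr.
  have [K defK] := block_hedge J; rewrite defK.
  apply: wedge_collapsible_in_HGbar => //; rewrite -defK; exact: collapsible_block.
move=> x y; apply: wedge_swap_mem.
rewrite hcomp_rightE; apply: wedge_suml_mem => J _.
apply: wedge_swap_mem; rewrite wedgeZr; apply: memvZ; apply: wedge_swap_mem.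
have [K defK] := block_hedge J; rewrite defK.
by apply: wedge_collapsible_in_HGbar => //; rewrite -defK; apply: collapsible_block_lift.
Qed.

End Stability.

(** * Minimality *)

(** Listing each set before its complement turns the permutation into the
correspondence between the entries of two lists. *)
Lemma exists_perm_imset (T : finType) (A B : {set T}) :
  #|A| = #|B| -> exists s : {perm T}, s @: A = B.
Proof.
move=> cAB; pose listing (C : {set T}) := enum C ++ enum (~: C).
have listing_uniq C : uniq (listing C).
  rewrite cat_uniq !enum_uniq /= andbT; apply/hasPn => x.
  by rewrite !mem_enum !inE.
have mem_listing C x : x \in listing C by rewrite mem_cat !mem_enum inE orbN.
have size_listing C : size (listing C) = #|T| by rewrite size_cat -!cardE cardsC.
have ltT x C : (index x (listing C) < #|T|)%N by rewrite -(size_listing C) index_mem.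
pose f x := nth x (listing B) (index x (listing A)).
have f_inj : injective f.
  move=> x y; rewrite /f (set_nth_default y) ?size_listing // => /eqP.
  by rewrite nth_uniq ?size_listing // => /eqP/index_inj; apply.
exists (perm f_inj); apply/eqP; rewrite eqEcard card_imset ?cAB ?leqnn ?andbT;
  last exact: perm_inj.
apply/subsetP => _ /imsetP[x Ax ->]; rewrite permE /f /listing.
have xA : x \in enum A by rewrite mem_enum.
have ltB : (index x (enum A) < size (enum B))%N by rewrite -cardE -cAB cardE index_mem.
by rewrite index_cat xA nth_cat ltB -mem_enum mem_nth.
Qed.

Section Minimality.
Variable k : nat.
Hypothesis k_gt0 : (0 < k)%N.

(** Converse of [collapsible_block_lift] for the whole block: the preimage x is
v restricted along a section w of the collapse map.  Off the block w is inverse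
to the collapse, and on the block the choice made by w does not matter, by
[collapsible_exchange]. *)
Lemma collapsible_is_lift n N (e : N = (n + k).-1) (p : 'I_n)
    (v : HGgen k N) :
  collapsible (block e p @: setT) v ->
  exists x, v = hcomp e p (x, 0).
Proof.
move=> vB; pose j0 : 'I_k := Ordinal k_gt0.
have lift (i : 'I_n) : exists z : 'I_N, collapse e p z == i.
  have [->|/(collapse_surj e)[z <-]] := eqVneq i p; last by exists z.
  by exists (block e p j0); apply/collapse_eqP; exists j0.
pose w i := xchoose (lift i).
have wK i : collapse e p (w i) = i by apply/eqP/(xchooseP (lift i)).
have w_inj : injective w by move=> i j /(congr1 (collapse e p)); rewrite !wK.
have mem_block z : (z \in block e p @: setT) = (collapse e p z == p).
  apply/imsetP/collapse_eqP => -[j]; last by exists j.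
  by exists j.
have w_out z : z \notin block e p @: setT -> w (collapse e p z) = z.
  by rewrite mem_block => /(@collapse_block_inj _ _ _ e p _ _ (esym (wK _))) <-.
pose x : HGgen k n := [ffun A : hedge k n => coef v (w @: val A)].
have coefx A : coef x A = coef v (w @: A).
  have [cA|cA] := eqVneq #|A| k; last by rewrite !coef_card ?card_imset.
  by have [I ->] := hedgeP cA; rewrite coef_val ffunE.
exists x; have [v2 _] := vB; have [x2 _] := collapsible_block_lift e p setT x.
apply: coefP => A cA.
case: (ltnP 1 #|A :&: block e p @: setT|) => [A2|]; first by rewrite v2 ?x2.
rewrite coef_hcomp ?cA // coef0 addr0 coefx.
rewrite leq_eqVlt ltnS leqn0 cards_eq0 setI_eq0.
have w_img (M : {set 'I_N}) : [disjoint M & block e p @: setT] ->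
    w @: (collapse e p @: M) = M.
  move=> dM; rewrite -imset_comp -[RHS]imset_id; apply: eq_in_imset => z Mz.
  by apply: w_out; rewrite (disjointFr dM Mz).
case/orP => [/cards1P[i eqAB] | dA]; last by rewrite w_img.
have /setIP[Ai Bi] : i \in A :&: block e p @: setT by rewrite eqAB set11.
rewrite -(setD1K Ai) !imsetU1 w_img; last first.
  rewrite -setI_eq0 setIDAC eqAB; apply/eqP/setP => z; rewrite !inE.
  by case: eqP.
apply: (collapsible_exchange vB) => //.
  by rewrite -cA (cardsD1 i A) Ai.
by rewrite mem_block wK -mem_block.
Qed.

(** After moving I to the last k inputs by a permutation, the wedge is the image
of a mixed relation of the direct sum, under the composition of V(n - k + 1)
with V(k) at the last input. *)
Lemma HGbar_minimal (S : forall n, skew_rel (HGgen k n)) :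
  is_operad (HGmaps k) S -> forall n, (HGbar k n <= S n)%VS.
Proof.
move=> opS n; apply: HGbar_subP => I v vI.
have cI : #|val I| = k by apply/eqP/(valP I).
have lekn : (k <= n)%N by rewrite -cI -[n in (_ <= n)%N]card_ord max_card.
have e : n = ((n - k).+1 + k).-1 by rewrite addSn /= subnK.
pose B : {set 'I_n} := block e ord_max @: [set: 'I_k].
have cB : #|B| = k by rewrite card_imset ?cardsT ?card_ord //; apply: block_inj.
have [s sI] : exists s : 'S_n, s @: val I = B.
  by apply: exists_perm_imset; rewrite cI.
have [x defx] : exists x, hact s v = hcomp e ord_max (x, 0).
  by apply: collapsible_is_lift; rewrite -/B -sI; apply: collapsible_hact.
have sW : wedge (hact s (hgen k (val I))) (hact s v) \in S n.
  have cT : #|[set: 'I_k]| = k by rewrite cardsT card_ord.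
  have [T defT] := hedgeP cT.
  rewrite HGact_hgen sI defx /B defT -(HGcomp_hgenr e ord_max T).
  apply: wedge_swap_mem.
  exact: (@qhom_oplus_wedge (QData (S (n - k).+1)) (QData (S k)) (QData (S n))
            _ x (hgen k (val T)) (comp_qhom opS e ord_max)).
have sK (y : HGgen k n) : hact s^-1%g (hact s y) = y.
  by rewrite -(act_mul opS) mulgV (act_id opS).
rewrite -[v]sK -[hgen k (val I)]sK -map_wedge.
exact: (subvP (act_qhom opS s^-1%g)) (memv_img _ sW).
Qed.

End Minimality.

Unset Implicit Arguments.

Theorem theorem5p4 (k : nat) (hk : (2 <= k)%N) :
  is_operad (HGmaps k) (HG k) /\
  is_smallest_suboperad (HGmaps k) (HG k) (HGbar k).
Proof.
have k_gt0 : (0 < k)%N := ltnW hk.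
split; first by apply: HG_is_operad => *; apply: qhom_wedge2.
split; last by move=> S [_ opS]; apply: HGbar_minimal.
split=> [n|]; first exact: HGbar_skew.
by apply: HG_is_operad => *; [apply: HGbar_hact | apply: HGbar_hcomp].
Qed.
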